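(* Let $f\colon p^{-1}(1)\to q^{-1}(1)$ be a homeomorphism between the fibres over $1\in S^1$ of the 2-adic solenoid $p\colon\mathrm{Sol}_2\to S^1$ and the 3-adic solenoid $q\colon\mathrm{Sol}_3\to S^1$, and let $r\colon\mathrm{Sol}_2\cup_f\mathrm{Sol}_3\to S^1\vee S^1$ be the resulting 2-3 solenoid. Then $\mathrm{Sol}_2\cup_f\mathrm{Sol}_3$ cannot be mapped over $S^1\vee S^1$ to any non-trivial connected covering space over $S^1\vee S^1$; that is, if $u\colon\widetilde X\to S^1\vee S^1$ is a covering projection with $\widetilde X$ connected and there is a continuous map $s\colon\mathrm{Sol}_2\cup_f\mathrm{Sol}_3\to\widetilde X$ with $u\circ s=r$, then $u$ is the trivial (one-sheeted) covering. As a consequence, $r\colon\mathrm{Sol}_2\cup_f\mathrm{Sol}_3\to S^1\vee S^1$ cannot be obtained as an inverse limit of coverings of $S^1\vee S^1$.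
   Context: For an integer $k\ge 2$, $\mathrm{Sol}_k$ is the inverse limit of the sequence $S^1\xleftarrow{\,k\,}S^1\xleftarrow{\,k\,}S^1\leftarrow\cdots$ of $k$-fold coverings $z\mapsto z^k$ of the unit circle $S^1\subset\mathbb{C}$, with the natural projection to the first $S^1$; its fibre over $1$ is identified with $\widehat{\mathbb{Z}}_k=\varprojlim_n\mathbb{Z}/k^n$. For $k=2,3$ these projections are denoted $p\colon\mathrm{Sol}_2\to S^1$ and $q\colon\mathrm{Sol}_3\to S^1$; both fibres are Cantor sets, so homeomorphisms $f\colon p^{-1}(1)\to q^{-1}(1)$ exist. The 2-3 solenoid is the quotient $\mathrm{Sol}_2\cup_f\mathrm{Sol}_3=(\mathrm{Sol}_2\sqcup\mathrm{Sol}_3)/(x\sim f(x),\ x\in p^{-1}(1))$. The map $r$ to the wedge $S^1\vee S^1$ of two circles (joined at $1$) is $p$ followed by inclusion of the first circle on $\mathrm{Sol}_2$, and $q$ followed by inclusion of the second circle on $\mathrm{Sol}_3$. Obtaining $r$ as an inverse limit of coverings means that there is an inverse sequence of covering spaces of $S^1\vee S^1$, with bonding maps over $S^1\vee S^1$, whose inverse limit with its natural projection is homeomorphic over $S^1\vee S^1$ to $r$. *)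

(* Defs.v *)
From HB Require Import structures.
From Stdlib Require Import Relation_Operators.
From mathcomp Require Import all_boot all_order all_algebra generic_quotient.
From mathcomp Require Import complex.
From mathcomp Require Import boolp classical_sets functions reals topology.
From mathcomp Require Import normedtype wedge_sigT.

Set Implicit Arguments.
Unset Strict Implicit.
Unset Printing Implicit Defensive.

Import Order.TTheory GRing.Theory Num.Theory.
Local Open Scope classical_set_scope.
Local Open Scope ring_scope.
Local Open Scope complex_scope.
Local Open Scope quotient_scope.

Section topological_notions.

Definition homeomorphism (X Y : topologicalType) (f : X -> Y) : Prop :=
  continuous f /\
  exists g : Y -> X, [/\ continuous g, cancel f g & cancel g f].

Definition homeomorphic_over (E E' B : topologicalType)
    (u : E -> B) (v : E' -> B) : Prop :=
  exists h : E -> E', homeomorphism h /\ forall x, v (h x) = u x.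

Definition fibre (E B : topologicalType) (u : E -> B) (b : B) : topologicalType :=
  set_type (u @^-1` [set b]).

(* S is the set of sheets over U; it may be empty, so that a covering map is
   not required to be surjective. *)
Definition evenly_covered (E B : topologicalType) (u : E -> B) (U : set B) :
    Prop :=
  exists S : set (set E),
    [/\ forall V, S V -> open V,
        trivIset S id,
        \bigcup_(V in S) V = u @^-1` U
      & forall V, S V -> exists h : set_type V -> set_type U,
          homeomorphism h /\ forall x, set_val (h x) = u (set_val x)].

Definition covering_map (E B : topologicalType) (u : E -> B) : Prop :=
  continuous u /\
  forall b : B, exists U : set B, [/\ open U, U b & evenly_covered u U].

(* The one-sheeted trivial covering of B is the identity of B. *)
Definition trivial_one_sheeted (E B : topologicalType) (u : E -> B) : Prop :=
  homeomorphic_over u (@id B).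

Definition inverse_limit (X : nat -> topologicalType)
    (b : forall n, X n.+1 -> X n) : topologicalType :=
  set_type [set x : prod_topology X | forall n, b n (x n.+1) = x n].

Definition limit_proj (X : nat -> topologicalType)
    (b : forall n, X n.+1 -> X n) (n : nat) (x : inverse_limit b) : X n :=
  (set_val x : prod_topology X) n.

Definition inverse_limit_of_coverings (E B : topologicalType) (r : E -> B) :
    Prop :=
  exists (X : nat -> topologicalType) (b : forall n, X n.+1 -> X n)
         (u : forall n, X n -> B),
    [/\ forall n, covering_map (u n),
        forall n, continuous (b n),
        forall n x, u n (b n x) = u n.+1 x
      & homeomorphic_over (fun x : inverse_limit b => u 0%N (limit_proj 0 x)) r].

End topological_notions.

Section gluing.
Variables (X Y : topologicalType) (A : set X) (f : set_type A -> Y).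

(* The disjoint union of X and Y is the sum over bool of this family. *)
Definition pair_family (i : bool) : topologicalType := if i then Y else X.

Definition disjoint_union : topologicalType := {i : bool & pair_family i}.

Definition in_left (x : X) : disjoint_union := existT pair_family false x.
Definition in_right (y : Y) : disjoint_union := existT pair_family true y.

Inductive glued : disjoint_union -> disjoint_union -> Prop :=
  Glued (x : set_type A) : glued (in_left (set_val x)) (in_right (f x)).

Let glue_rel' (s t : disjoint_union) : bool :=
  `[< clos_refl_sym_trans _ glued s t >].

Local Lemma glue_rel_refl : reflexive glue_rel'.
Proof. by move=> s; apply/asboolP; exact: rst_refl. Qed.

Local Lemma glue_rel_sym : symmetric glue_rel'.
Proof.
by move=> s t; apply/idP/idP => /asboolP st; apply/asboolP; exact: rst_sym.
Qed.

Local Lemma glue_rel_trans : transitive glue_rel'.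
Proof.
by move=> t s w /asboolP st /asboolP tw; apply/asboolP; exact: rst_trans st tw.
Qed.

Definition glue_rel := EquivRel _ glue_rel_refl glue_rel_sym glue_rel_trans.

Definition adjunction := {eq_quot glue_rel}.

HB.instance Definition _ :=
  Topological.copy adjunction (quotient_topology adjunction).
HB.instance Definition _ := Quotient.on adjunction.

Lemma glue_eqP (s t : disjoint_union) :
  \pi_adjunction s = \pi_adjunction t <-> clos_refl_sym_trans _ glued s t.
Proof.
by split=> [/eqmodP/asboolP//|st]; apply/eqmodP/asboolP.
Qed.

Lemma glueE (x : set_type A) :
  \pi_adjunction (in_left (set_val x)) = \pi_adjunction (in_right (f x)).
Proof. exact/glue_eqP/rst_step. Qed.

End gluing.

Section solenoids.
Variable R : realType.

Definition circle : topologicalType :=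
  set_type [set z : R[i]^o | `|z| = 1].

Lemma circle_one_subproof : (1 : R[i]^o) \in [set z : R[i]^o | `|z| = 1].
Proof. by rewrite inE /= normr1. Qed.

Definition circle_one : circle := exist _ (1 : R[i]^o) circle_one_subproof.

Lemma circle_pow_subproof (k : nat) (z : circle) :
  ((set_val z : R[i]) ^+ k : R[i]^o) \in [set z : R[i]^o | `|z| = 1].
Proof.
by have zE : `|set_val z| = 1 := set_valP z; rewrite inE /= normrX zE expr1n.
Qed.

Definition circle_pow (k : nat) (z : circle) : circle :=
  exist _ ((set_val z : R[i]) ^+ k : R[i]^o) (circle_pow_subproof k z).

Definition solenoid (k : nat) : topologicalType :=
  @inverse_limit (fun=> circle) (fun=> circle_pow k).

Definition solenoid_proj (k : nat) (x : solenoid k) : circle := limit_proj 0 x.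

(* S^1 \/ S^1; the index false is the first circle, true the second one. *)
Definition wedge_circles : topologicalType :=
  @wedge bool (fun=> circle) (fun=> circle_one).

Definition wedge_in (i : bool) (z : circle) : wedge_circles :=
  @wedge_lift bool (fun=> circle) (fun=> circle_one) i z.

Section two_three.
Variable f : fibre (@solenoid_proj 2) circle_one ->
             fibre (@solenoid_proj 3) circle_one.

Definition solenoid23_attach (x : fibre (@solenoid_proj 2) circle_one) :
  solenoid 3 := set_val (f x).

Definition solenoid23 : topologicalType := adjunction solenoid23_attach.

Definition sum_proj (s : disjoint_union (solenoid 2) (solenoid 3)) :
    wedge_circles :=
  match s with
  | existT false x => wedge_in false (@solenoid_proj 2 x)
  | existT true y => wedge_in true (@solenoid_proj 3 y)
  end.

(* Independent of the representative, see solenoid23_projE. *)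
Definition solenoid23_proj (x : solenoid23) : wedge_circles :=
  sum_proj (repr (x : adjunction _)).

Lemma solenoid23_projE s :
  solenoid23_proj (\pi_(adjunction _) s) = sum_proj s.
Proof.
rewrite /solenoid23_proj.
have /glue_eqP := reprK (\pi_(adjunction solenoid23_attach) s).
move: (repr _) => t; elim => // [_ _ [x]|a b c _ -> _ -> //].
have := set_valP (f x); have := set_valP x; rewrite /sum_proj /= => -> ->.
exact: (@wedge_liftE _ (fun=> circle) (fun=> circle_one) true circle_one false
  circle_one).
Qed.

End two_three.
End solenoids.

(* Main.v *)
Require Import Defs.
From mathcomp Require Import all_boot all_order all_algebra.
From mathcomp Require Import complex.
From mathcomp Require Import boolp classical_sets functions cardinality.
From mathcomp Require Import reals topology.
From mathcomp Require Import normedtype trigo wedge_sigT.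

Set Implicit Arguments.
Unset Strict Implicit.
Unset Printing Implicit Defensive.

Import Order.TTheory GRing.Theory Num.Theory numFieldNormedType.Exports.
Local Open Scope classical_set_scope.
Local Open Scope ring_scope.

(** The fundamental group of the wedge is free on the two loops, and a covering
    u of it is governed by the action of these loops on the fibre F over the
    wedge point.  Let s be a map over the wedge from the 2-3 solenoid, and let K
    be the image in F of the common fibre of the two solenoids.

    The real line acts on the k-adic solenoid by moving the n-th coordinate
    through the angle t / k^n of a full turn ([flow]).  At time 1 this preserves
    the fibre over 1 and acts on it as the odometer, adding 1 to a k-adic
    integer.  Flow lines are lifts of the path that winds around the circle, so
    uniqueness of lifts shows that the value of s along a flow line is determined
    by its value at time 0 ([lift_flow]).  Hence the odometer induces a
    permutation of K.  Since F is discrete, s is constant on the points of the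
    fibre that share with 1 their first n coordinates, for some n; therefore K is
    a single cycle whose length divides k^n ([lift_fibre_card]).

    Both solenoids have the same K, because the gluing f maps one fibre onto the
    other.  So the cardinal of K divides a power of 2 and a power of 3, and K is
    a point ([lift_fibre_const]).

    It follows that s is constant on all fibres of the projection r, and factors
    as s = sg r with sg a continuous section of u ([lift_section]).  Uniqueness
    of lifts, applied to the identity and to sg u on the connected total space,
    shows that sg is inverse to u.

    The constancy on the fibre over the wedge point holds for coverings with an
    arbitrary total space.  If r were the inverse limit of coverings X_n, then
    the map from the 2-3 solenoid to each X_n would be constant on this fibre.
    These maps separate points, but the fibre has more than one point. *)

(** * Uniqueness of lifts *)

Section coverings.
Variables (E B Y : topologicalType) (u : E -> B).
Hypothesis covu : covering_map u.

(** Sheets V and V' over the same open set are equal or disjoint, and u is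
    injective on each; so whether two points of V and V' with the same image
    coincide does not depend on the points, and means V = V'. *)
Lemma covering_nbhs_eq (y y' : E) : u y = u y' -> exists V V' : set E,
  [/\ open V, open V', V y, V' y' &
    forall z z', V z -> V' z' -> u z = u z' -> (z = z' <-> y = y')].
Proof.
move=> uyy'.
have [_ /(_ (u y)) [U [oU Uy [S [oS tS SE hS]]]]] := covu.
have inj V x x' : S V -> V x -> V x' -> u x = u x' -> x = x'.
  move=> SV Vx Vx' uxx'; have [h [[_ [g [_ gK _]]] hE]] := hS _ SV.
  have := hE (exist _ x (mem_set Vx)); have := hE (exist _ x' (mem_set Vx')).
  rewrite /= [in RHS]set_valE /= -uxx' => <- /val_inj /(can_inj gK).
  by case.
have : (u @^-1` U) y by []; have : (u @^-1` U) y' by rewrite /preimage /= -uyy'.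
rewrite -SE => -[V' SV' Vy'] [V SV Vy]; exists V, V'.
split=> //; [exact: oS|exact: oS|move=> z z' Vz Vz' uzz'; split=> e].
  have VV' : V = V' by apply: tS => //; exists z; split=> //; rewrite e.
  by apply: (inj V) => //; rewrite VV'.
have VV' : V = V' by apply: tS => //; exists y; split=> //; rewrite e.
by apply: (inj V) => //; rewrite VV'.
Qed.

Lemma near_lifts_eq (g h : Y -> E) :
  continuous g -> continuous h -> (forall y, u (g y) = u (h y)) ->
  forall y, \forall z \near y, (g z = h z <-> g y = h y).
Proof.
move=> cg ch gh y; have [V [V' [oV oV' Vy Vy' eqV]]] := covering_nbhs_eq (gh y).
near=> z; apply: eqV => //; near: z.
  by apply: cg; exact: open_nbhs_nbhs.
by apply: ch; exact: open_nbhs_nbhs.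
Unshelve. all: by end_near. Qed.

Lemma unique_lifting (g h : Y -> E) (y0 : Y) : connected [set: Y] ->
  continuous g -> continuous h -> (forall y, u (g y) = u (h y)) ->
  g y0 = h y0 -> g =1 h.
Proof.
move=> cY cg ch gh e0; pose A := [set y | g y = h y].
have gh_near := near_lifts_eq cg ch gh.
suff : A = setT by move=> AT y; have : [set: Y] y by []; rewrite -AT.
apply: cY; first by exists y0.
  exists A; rewrite ?setTI // openE => y /= Ay.
  by apply: filterS (gh_near y) => z zy; exact/zy.
exists A; rewrite ?setTI //.
rewrite -[A]setCK; apply: open_closedC; rewrite openE => y /= Ay.
by apply: filterS (gh_near y) => z zy /zy.
Qed.

End coverings.

(** * The circle as a quotient of the line *)

Lemma continuous_into_subtype (T X : topologicalType) (A : set T)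
  (f : X -> set_type A) : continuous (fun x => set_val (f x)) -> continuous f.
Proof. exact: continuous_comp_initial. Qed.

Section circle.
Variable R : realType.
Local Notation circle := (circle R).

Definition cis (t : R) : R[i] := (cos t +i* sin t)%C.

Lemma normc_eq1 (z : R[i]) :
  (`|z| == 1) = (complex.Re z ^+ 2 + complex.Im z ^+ 2 == 1).
Proof.
rewrite normc_def -[1 in LHS]/(1%:C)%C eq_complex /= eqxx andbT.
by rewrite -{1}(@sqrtr1 R) eqr_sqrt // addr_ge0 ?sqr_ge0.
Qed.

Lemma cisD t t' : cis (t + t') = cis t * cis t'.
Proof.
by rewrite /cis cosD sinD; apply/eqP; rewrite eq_complex /= eqxx addrC eqxx.
Qed.

Lemma norm_cis t : `|cis t| = 1.
Proof. by apply/eqP; rewrite normc_eq1 /= cos2Dsin2. Qed.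

Lemma norm_le_ReIm (z : R[i]) :
  `|z| <= ((`|complex.Re z| + `|complex.Im z|)%:C)%C.
Proof.
rewrite normc_def lecR -[leRHS]ger0_norm ?addr_ge0 // -sqrtr_sqr.
rewrite ler_sqrt ?sqr_ge0 // sqrrD !real_normK ?num_real //.
by rewrite addrAC lerDl mulrn_wge0 // mulr_ge0.
Qed.

Lemma norm_ge_Im (z : R[i]) : `|complex.Im z|%:C%C <= `|z|.
Proof.
rewrite normc_def /= lecR -sqrtr_sqr ler_sqrt ?addr_ge0 ?sqr_ge0//.
by rewrite lerDr sqr_ge0.
Qed.

Lemma cis_continuous : continuous (cis : R -> R[i]^o).
Proof.
move=> t; apply/cvgrPdist_lt => -[a b]; rewrite ltcE /= => /andP[/eqP -> a0].
near=> t'; apply: le_lt_trans (norm_le_ReIm _) _; rewrite ltcR /=.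
rewrite (splitr a) ltrD //; near: t'.
  by apply: (@cvgr_dist_lt _ R); [exact: continuous_cos|rewrite divr_gt0].
by apply: (@cvgr_dist_lt _ R); [exact: continuous_sin|rewrite divr_gt0].
Unshelve. all: by end_near. Qed.

Lemma Im_continuous : continuous (@complex.Im R : R[i]^o -> R).
Proof.
move=> z A /nbhs_ballP [e /= e0 eA].
have e0' : 0 < e%:C%C :> R[i] by rewrite ltcR.
apply: filterS (@nbhsx_ballx R[i] R[i]^o z e%:C%C e0') => w zw.
apply: eA; rewrite /ball /= -ltcR; apply: le_lt_trans zw.
rewrite -raddfB; exact: norm_ge_Im.
Qed.

Lemma Re_continuous : continuous (@complex.Re R : R[i]^o -> R).
Proof.
move=> z A /nbhs_ballP [e /= e0 eA].
have e0' : 0 < e%:C%C :> R[i] by rewrite ltcR.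
apply: filterS (@nbhsx_ballx R[i] R[i]^o z e%:C%C e0') => w zw.
apply: eA; rewrite /ball /= -ltcR; apply: le_lt_trans zw.
rewrite -raddfB; exact: normc_ge_Re.
Qed.

Lemma circle_mul_subproof (z w : circle) :
  (set_val z * set_val w : R[i]^o) \in [set z : R[i]^o | `|z| = 1].
Proof.
have zE : `|set_val z| = 1 := set_valP z.
have wE : `|set_val w| = 1 := set_valP w.
by rewrite inE /= normrM zE wE mulr1.
Qed.

Definition circle_mul (z w : circle) : circle :=
  exist _ (set_val z * set_val w : R[i]^o) (circle_mul_subproof z w).

Lemma circle_exp_subproof (t : R) :
  (cis (2 * pi * t) : R[i]^o) \in [set z : R[i]^o | `|z| = 1].
Proof. by rewrite inE /= norm_cis. Qed.

(** Normalized to have period 1. *)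
Definition circle_exp (t : R) : circle :=
  exist _ (cis (2 * pi * t) : R[i]^o) (circle_exp_subproof t).

Lemma circle_mulA : associative circle_mul.
Proof. by move=> x y z; apply/val_inj; rewrite /= mulrA. Qed.

Lemma circle_mul1 z : circle_mul z (circle_one R) = z.
Proof. by apply/val_inj; rewrite /= mulr1. Qed.

Lemma circle_mulC : commutative circle_mul.
Proof. by move=> x y; apply/val_inj; rewrite /= mulrC. Qed.

Lemma circle_expD t t' :
  circle_exp (t + t') = circle_mul (circle_exp t) (circle_exp t').
Proof. by apply/val_inj; rewrite /= mulrDr cisD. Qed.

Lemma circle_exp0 : circle_exp 0 = circle_one R.
Proof. by apply/val_inj; rewrite /= mulr0 /cis cos0 sin0. Qed.

Lemma circle_powM k z w :
  circle_pow k (circle_mul z w) = circle_mul (circle_pow k z) (circle_pow k w).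
Proof. by apply/val_inj; rewrite /= exprMn. Qed.

Lemma circle_pow_exp k t : circle_pow k (circle_exp t) = circle_exp (t * k%:R).
Proof.
elim: k => [|k IH]; first by rewrite mulr0 circle_exp0; apply/val_inj.
rewrite -natr1 mulrDr mulr1 circle_expD -IH.
by apply/val_inj; rewrite /= exprSr.
Qed.

Lemma circle_exp_continuous : continuous circle_exp.
Proof.
apply: continuous_into_subtype => t.
have := @continuous_comp R R R[i]^o ( *%R (2 * pi)) cis t.
by apply; [exact: mulrl_continuous|exact: cis_continuous].
Qed.

Lemma circle_mul_continuous z : continuous (circle_mul z).
Proof.
apply: continuous_into_subtype => w.
have := @continuous_comp circle R[i]^o R[i]^o set_val ( *%R (set_val z)) w.
by apply; [exact: initial_continuous|exact: mulrl_continuous].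
Qed.

Definition circle_Im (z : circle) : R := complex.Im (set_val z).
Definition circle_Re (z : circle) : R := complex.Re (set_val z).

Lemma circle_ReIm z : circle_Re z ^+ 2 + circle_Im z ^+ 2 = 1.
Proof. by apply/eqP; rewrite -normc_eq1; apply/eqP; exact: (set_valP z). Qed.

Lemma circle_Im_continuous : continuous circle_Im.
Proof.
move=> z; have := @continuous_comp circle R[i]^o R set_val (@complex.Im R) z.
by apply; [exact: initial_continuous|exact: Im_continuous].
Qed.

Lemma circle_Re_continuous : continuous circle_Re.
Proof.
move=> z; have := @continuous_comp circle R[i]^o R set_val (@complex.Re R) z.
by apply; [exact: initial_continuous|exact: Re_continuous].
Qed.

End circle.

Section circle_exp_theory.
Variable R : realType.
Local Notation circle := (circle R).
Local Notation circle_exp := (@circle_exp R).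

Lemma pi2_gt0 : 0 < 2 * pi :> R.
Proof. by rewrite mulr_gt0 // pi_gt0. Qed.

Lemma circle_eqP (z w : circle) :
  circle_Re z = circle_Re w -> circle_Im z = circle_Im w -> z = w.
Proof.
by move=> eR eI; apply/val_inj/eqP; rewrite eq_complex; apply/andP; split;
  apply/eqP.
Qed.

Lemma circle_Re_exp t : circle_Re (circle_exp t) = cos (2 * pi * t).
Proof. by []. Qed.

Lemma circle_Im_exp t : circle_Im (circle_exp t) = sin (2 * pi * t).
Proof. by []. Qed.

Lemma circle_exp_nat (j : nat) : circle_exp j%:R = circle_one R.
Proof.
rewrite -[j%:R]mul1r -circle_pow_exp; have -> : circle_exp 1 = circle_one R.
  apply: circle_eqP; rewrite ?circle_Re_exp ?circle_Im_exp mulr1 mulr_natl.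
    by rewrite cos2pi.
  by rewrite sin2pi.
by apply/val_inj; rewrite /= expr1n.
Qed.

(** Modulo 1, the time t lies in [0, 1[; cos is injective on the two halves
    of a full turn and takes the value 1 at its start and at its end. *)
Lemma circle_exp_ker (t : R) : 0 <= t -> circle_exp t = circle_one R ->
  exists j : nat, t = j%:R.
Proof.
move=> t0 et; exists (Num.truncn t).
have /andP[jt tj] := truncn_itv t0.
set j := Num.truncn t in jt tj *.
pose t' := t - j%:R.
have t'0 : 0 <= t' by rewrite subr_ge0.
have t'1 : t' < 1 by rewrite ltrBlDl natr1.
have cos1 : cos (2 * pi * t') = 1 :> R.
  move: et; rewrite -[t](subrK j%:R) circle_expD circle_exp_nat circle_mul1.
  by move/(congr1 (@circle_Re R)).
have pi2 := pi2_gt0.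
suff : t' = 0 by move/eqP; rewrite subr_eq0 => /eqP.
have [h|h] := leP t' 2^-1.
  have : 2 * pi * t' = 0 :> R.
    apply: cos_inj; rewrite ?cos0 // in_itv /= ?lexx ?pi_ge0 //.
    rewrite mulr_ge0 ?(ltW pi2)//= mulrAC -ler_pdivlMr ?pi_gt0//.
    by rewrite mulfV ?gt_eqF ?pi_gt0 // -ler_pdivlMl // mulr1.
  by move/eqP; rewrite mulf_eq0 gt_eqF //= => /eqP.
have : 2 * pi * (1 - t') = 0 :> R.
  apply: cos_inj; rewrite ?cos0 ?in_itv /= ?lexx ?pi_ge0 //.
    rewrite mulr_ge0 ?(ltW pi2) ?subr_ge0 ?(ltW t'1)//=.
    rewrite mulrAC -ler_pdivlMr ?pi_gt0// mulfV ?gt_eqF ?pi_gt0 //.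
    rewrite -ler_pdivlMl // mulr1.
    rewrite lerBlDl -lerBlDr; apply: le_trans (ltW h).
    by rewrite {1}(splitr 1) mul1r addrK.
  by rewrite mulrBr mulr1 mulr_natl addrC cosD2pi cosN -mulr_natl cos1.
move/eqP; rewrite mulf_eq0 gt_eqF //= subr_eq0 => /eqP e.
by rewrite -e ltxx in t'1.
Qed.

(** A nonnegative time is chosen so that the times at which a root of unity is
    reached are natural multiples of a fraction. *)
Lemma circle_exp_surj (z : circle) : exists t : R, 0 <= t /\ circle_exp t = z.
Proof.
have h := circle_ReIm z.
have Re1 : -1 <= circle_Re z <= 1.
  rewrite -ler_norml -(@ler_pXn2r _ 2) ?nnegrE// expr1n real_normK ?num_real//.
  by rewrite -h lerDl sqr_ge0.
have ReE := acosK (_ : circle_Re z \in `[-1, 1]).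
have pi2 := pi2_gt0; have pi2N : 2 * pi != 0 :> R by rewrite gt_eqF.
have Im2 : sin (acos (circle_Re z)) = `|circle_Im z|.
  by rewrite sin_acos // -h addrC addKr sqrtr_sqr.
have [I0|I0] := leP 0 (circle_Im z).
  exists (acos (circle_Re z) / (2 * pi)); split.
    by rewrite divr_ge0 ?(ltW pi2) // acos_ge0.
  apply: circle_eqP;
    rewrite ?circle_Re_exp ?circle_Im_exp mulrCA mulfV // mulr1.
    by rewrite ReE.
  by rewrite Im2 ger0_norm.
exists (1 - acos (circle_Re z) / (2 * pi)); split.
  rewrite subr_ge0 ler_pdivrMr // mul1r (le_trans (acos_lepi _)) //.
  by rewrite mulr_natl mulr2n lerDl pi_ge0.
apply: circle_eqP;
  rewrite ?circle_Re_exp ?circle_Im_exp mulrBr mulr1 mulrCA mulfV // mulr1.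
  by rewrite mulr_natl addrC cosD2pi cosN ReE.
by rewrite mulr_natl addrC sinD2pi sinN Im2 ltr0_norm // opprK.
Qed.

(** The argument, as a fraction of a full turn, of a point of the right half of
    the circle. *)
Definition circle_log (z : circle) : R := asin (circle_Im z) / (2 * pi).

Lemma circle_logK z : 0 < circle_Re z -> circle_exp (circle_log z) = z.
Proof.
move=> Re0; have h := circle_ReIm z.
have Im1 : -1 <= circle_Im z <= 1.
  rewrite -ler_norml -(@ler_pXn2r _ 2) ?nnegrE// expr1n real_normK ?num_real//.
  by rewrite -h lerDr sqr_ge0.
have pi2N : 2 * pi != 0 :> R by rewrite gt_eqF ?pi2_gt0.
have angle : 2 * pi * circle_log z = asin (circle_Im z).
  by rewrite mulrCA mulfV // mulr1.
apply: circle_eqP.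
  by rewrite circle_Re_exp angle cos_asin // -h addrK sqrtr_sqr gtr0_norm.
by rewrite circle_Im_exp angle asinK.
Qed.

Lemma circle_log_continuous : {for circle_one R, continuous circle_log}.
Proof.
have Im0 : circle_Im (circle_one R) = 0 by [].
apply: (@continuous_comp _ _ _ (@circle_Im R) (fun y => asin y / (2 * pi))).
  exact: circle_Im_continuous.
have := @continuous_comp R R R (@asin R) ( *%R^~ (2 * pi)^-1)
  (circle_Im (circle_one R)).
apply; last exact: mulrr_continuous.
by apply: continuous_asin; rewrite Im0 ltrN10 ltr01.
Qed.

Lemma circle_log1 : circle_log (circle_one R) = 0.
Proof.
rewrite /circle_log; have -> : circle_Im (circle_one R) = 0 by [].
have := @sinK R 0; rewrite sin0 => ->; first by rewrite mul0r.
by rewrite in_itv /= oppr_le0 divr_ge0 ?pi_ge0.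
Qed.

(** The exponential is a quotient map, since [circle_log] translated to a point
    of the circle is a continuous section near that point. *)
Lemma continuous_from_circle (X : topologicalType) (g : circle -> X) :
  continuous (g \o circle_exp) -> continuous g.
Proof.
move=> cg z0; have [t0 [_ <-]] := circle_exp_surj z0.
pose theta (z : circle) := t0 + circle_log (circle_mul (circle_exp (- t0)) z).
have unit0 : circle_mul (circle_exp (- t0)) (circle_exp t0) = circle_one R.
  by rewrite -circle_expD addNr circle_exp0.
have theta0 : theta (circle_exp t0) = t0.
  by rewrite /theta unit0 circle_log1 addr0.
have gE : \forall z \near circle_exp t0, g (circle_exp (theta z)) = g z.
  have : \forall z \near circle_exp t0,
      0 < circle_Re (circle_mul (circle_exp (- t0)) z).
    have c : {for circle_exp t0, continuous (fun z =>
        circle_Re (circle_mul (circle_exp (- t0)) z))}.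
      apply: (@continuous_comp circle circle R).
        exact: circle_mul_continuous.
      exact: circle_Re_continuous.
    by apply: (c [set y | 0 < y]); apply: lt_nbhsr; rewrite unit0 ltr01.
  apply: filterS => z z0'.
  rewrite circle_expD circle_logK // circle_mulA -circle_expD subrr circle_exp0.
  by rewrite circle_mulC circle_mul1.
apply: cvg_trans (near_eq_cvg gE) _.
have ctheta : theta z @[z --> circle_exp t0] --> t0.
  have clog :
      circle_log (circle_mul (circle_exp (- t0)) z) @[z --> circle_exp t0]
      --> circle_log (circle_mul (circle_exp (- t0)) (circle_exp t0)).
    have := @continuous_comp circle circle R (circle_mul (circle_exp (- t0)))
      circle_log (circle_exp t0).
    apply; first exact: circle_mul_continuous.
    by rewrite unit0; exact: circle_log_continuous.
  rewrite -[X in _ --> X]theta0.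
  exact: (cvgD (cvg_cst t0) clog).
exact: (cvg_comp theta (g \o circle_exp) ctheta (cg t0)).
Qed.

End circle_exp_theory.

(** * Sequences with an invertible shift *)

Section periodic_sequence.
Variables (T : choiceType) (a : nat -> T).
Hypothesis a_shift : forall i j m, a (i + m)%N = a (j + m)%N <-> a i = a j.

(** The least period d of such a sequence divides every period, and the d first
    terms are distinct. *)
Lemma periodic_range_card (N : nat) : (0 < N)%N -> a N = a 0%N ->
  exists d, (d %| N)%N /\ (range a #= `I_d)%card.
Proof.
move=> N0 aN.
have ex : exists d, (0 < d)%N && (a d == a 0%N).
  by exists N; rewrite N0 aN eqxx.
case: (ex_minnP ex) => d /andP[d0 /eqP ad] dmin; exists d.
have aMd m : a (m * d)%N = a 0%N.
  elim: m => // m <-; rewrite mulSn.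
  by apply/(a_shift d 0%N (m * d)).
have amod j : a j = a (j %% d)%N.
  rewrite {1}(divn_eq j d); by apply/(a_shift (j %/ d * d)%N 0%N (j %% d)).
split.
  rewrite /dvdn; apply/negPn/negP; rewrite -lt0n => r0.
  have := dmin (N %% d)%N; rewrite r0 -amod aN eqxx => /(_ isT).
  by rewrite leqNgt ltn_pmod.
have -> : range a = a @` `I_d.
  apply/seteqP; split => [_ [j _ <-]|_ [j _ <-]]; last by exists j.
  by exists (j %% d)%N; rewrite /= ?ltn_pmod.
apply: inj_card_eq => i j; rewrite !inE /=.
wlog ij : i j / (i <= j)%N => [W id jd e|id jd e].
  by case/orP: (leq_total i j) => h; [|apply/esym]; apply: W.
have : a (j - i)%N = a 0%N by apply/(a_shift (j - i)%N 0%N i); rewrite subnK.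
move=> aji; apply/eqP; rewrite eqn_leq ij /= -subn_eq0 -leqn0 leqNgt.
apply/negP => ji0; have := dmin (j - i)%N; rewrite ji0 aji eqxx => /(_ isT).
by rewrite leqNgt (leq_ltn_trans (leq_subr _ _)).
Qed.
End periodic_sequence.

(** * Inverse limits *)

Section inverse_limits.
Variables (X : nat -> topologicalType) (b : forall n, X n.+1 -> X n).

Lemma limit_eqP (x y : inverse_limit b) :
  (forall n, limit_proj n x = limit_proj n y) -> x = y.
Proof. by move=> h; apply/val_inj/functional_extensionality_dep. Qed.

Lemma limit_projS n (x : inverse_limit b) :
  b (limit_proj n.+1 x) = limit_proj n x.
Proof. by have := set_valP x; exact. Qed.

(** The topology of the limit is the initial one for the coordinates, so
    convergence is checked one coordinate at a time. *)
Lemma cvg_into_limit (T : Type) (F : set_system T) (g : T -> inverse_limit b)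
    (x : inverse_limit b) : Filter F ->
  (forall n, limit_proj n (g t) @[t --> F] --> limit_proj n x) -> g @ F --> x.
Proof.
move=> FF gx.
have cvgP : (set_val (g t) : prod_topology X) @[t --> F] -->
            (set_val x : prod_topology X).
  apply/cvg_sup => n U [V] [[W] oW <-] WfN WU.
  apply: (filterS WU); apply: (gx n).
  by apply: open_nbhs_nbhs; split.
move=> U [V [[W oW <-] Wx WU]]; apply: (filterS WU); apply: cvgP.
exact: open_nbhs_nbhs.
Qed.

Lemma limit_proj_continuous n : continuous (@limit_proj X b n).
Proof.
move=> x; have := @continuous_comp (inverse_limit b) (prod_topology X) (X n)
  set_val (fun y => y n) x; apply; first exact: initial_continuous.
exact: proj_continuous.
Qed.

End inverse_limits.

(** * Lifts along a solenoid *)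

Section solenoid.
Variables (R : realType) (k : nat).
Hypothesis k0 : (0 < k)%N.
Local Notation solenoid := (solenoid R k).
Local Notation circle := (circle R).
Local Notation proj := (@solenoid_proj R k).

Lemma solenoid_projS n (x : solenoid) :
  circle_pow k (limit_proj n.+1 x) = limit_proj n x.
Proof. exact: (limit_projS n x). Qed.

Lemma powk_neq0 n : (k ^ n)%:R != 0 :> R.
Proof. by rewrite pnatr_eq0 -lt0n expn_gt0 k0. Qed.

Lemma flow_subproof t (x : solenoid) :
  (fun n => circle_mul (limit_proj n x) (circle_exp (t / (k ^ n)%:R)))
  \in [set x : prod_topology (fun=> circle) |
        forall n, circle_pow k (x n.+1) = x n].
Proof.
rewrite inE /= => n; rewrite circle_powM solenoid_projS circle_pow_exp.
congr (circle_mul _ (circle_exp _)).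
by rewrite expnSr natrM invfM mulrA divfK // pnatr_eq0 -lt0n.
Qed.

(** A k-adic version of the winding of the line around the circle: the n-th
    coordinate is rotated by t / k^n of a full turn, which the k-th power map
    sends to the rotation of the preceding coordinate.  The time-1 map is the
    odometer on each fibre. *)
Definition flow t (x : solenoid) : solenoid :=
  exist _ (fun n => circle_mul (limit_proj n x) (circle_exp (t / (k ^ n)%:R)))
    (flow_subproof t x).

Lemma limit_proj_flow n t (x : solenoid) :
  limit_proj n (flow t x) =
  circle_mul (limit_proj n x) (circle_exp (t / (k ^ n)%:R)).
Proof. by []. Qed.

Lemma solenoid_proj_flow t x :
  proj (flow t x) = circle_mul (proj x) (circle_exp t).
Proof. by rewrite /solenoid_proj limit_proj_flow expn0 divr1. Qed.

Lemma flowD t t' x : flow (t + t') x = flow t (flow t' x).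
Proof.
apply: limit_eqP => n; rewrite !limit_proj_flow mulrDl addrC circle_expD.
by rewrite circle_mulA.
Qed.

Lemma flow0 x : flow 0 x = x.
Proof.
by apply: limit_eqP => n; rewrite limit_proj_flow mul0r circle_exp0 circle_mul1.
Qed.

Lemma flow_continuous x : continuous (flow^~ x).
Proof.
move=> t; apply: cvg_into_limit => n.
have ct : continuous (fun t : R => circle_exp (t / (k ^ n)%:R)).
  move=> {}t; have := @continuous_comp R R circle ( *%R^~ (k ^ n)%:R^-1)
    (@circle_exp R) t.
  by apply; [exact: mulrr_continuous|exact: circle_exp_continuous].
have := @continuous_comp R circle circle _ _ t (ct t)
  (@circle_mul_continuous R (limit_proj n x) _).
exact.
Qed.

Lemma solenoid_one_subproof :
  (fun=> circle_one R)
  \in [set x : prod_topology (fun=> circle) |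
        forall n, circle_pow k (x n.+1) = x n].
Proof. by rewrite inE /= => n; apply/val_inj; rewrite /= expr1n. Qed.

Definition solenoid_one : solenoid :=
  exist _ (fun=> circle_one R) solenoid_one_subproof.

Lemma limit_proj_pow n (x : solenoid) :
  circle_pow (k ^ n) (limit_proj n x) = proj x.
Proof.
elim: n => [|n <-]; first by apply/val_inj; rewrite /= expn0 expr1.
by rewrite -(solenoid_projS n); apply/val_inj; rewrite /= -exprM expnS.
Qed.

Lemma limit_proj_one_le m n (x : solenoid) : (m <= n)%N ->
  limit_proj n x = circle_one R -> limit_proj m x = circle_one R.
Proof.
elim: n => [|n IH]; first by rewrite leqn0 => /eqP ->.
rewrite leq_eqVlt => /predU1P[->//|mn] h; apply: IH => //.
by rewrite -(solenoid_projS n) h; apply/val_inj; rewrite /= expr1n.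
Qed.

Lemma proj_flow_nat (j : nat) x : proj (flow j%:R x) = proj x.
Proof. by rewrite solenoid_proj_flow circle_exp_nat circle_mul1. Qed.

Lemma proj_flowN_nat (j : nat) x : proj (flow (- j%:R) x) = proj x.
Proof. by rewrite -[in RHS](flow0 x) -(subrr j%:R) flowD proj_flow_nat. Qed.

Section lift.
Variables (E B : topologicalType) (u : E -> B) (g : circle -> B).
Variable s : solenoid -> E.
Hypothesis covu : covering_map u.
Hypothesis cs : continuous s.
Hypothesis us : forall x, u (s x) = g (proj x).

(** Two points of one fibre have flow lines over the same path of the circle, so
    their images under s are two lifts of one path. *)
Lemma lift_flow t x y : proj x = proj y -> s x = s y ->
  s (flow t x) = s (flow t y).
Proof.
move=> pxy sxy.
have cR : connected [set: R] by apply/connected_intervalP.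
have cf z : continuous (fun t => s (flow t z)).
  move=> r; apply: (@continuous_comp R solenoid E (flow^~ z) s).
    exact: flow_continuous.
  exact: cs.
apply: (@unique_lifting _ _ _ u covu (fun t => s (flow t x))
  (fun t => s (flow t y)) 0) => //.
  by move=> r; rewrite !us !solenoid_proj_flow pxy.
by rewrite !flow0.
Qed.

(** Fibres of a covering are discrete, so s is constant on a neighbourhood of 1
    in the fibre of the solenoid.  A neighbourhood of this form is obtained from a
    sequence: points that share with 1 more and more coordinates tend to 1. *)
Lemma lift_const_near_one : exists n, forall x, proj x = circle_one R ->
  limit_proj n x = circle_one R -> s x = s solenoid_one.
Proof.
apply: contrapT => /forallNP H.
have /choice[x xP] : forall n, exists x, [/\ proj x = circle_one R,
    limit_proj n x = circle_one R & s x <> s solenoid_one].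
  move=> n; have /existsNP[x /not_implyP[? /not_implyP[? ?]]] := H n.
  by exists x.
have xcvg : x @ \oo --> solenoid_one.
  apply: cvg_into_limit => m; apply: cvg_near_cst.
  exists m => // n /= mn; have [_ xn _] := xP n.
  exact: limit_proj_one_le xn.
have [V [V' [oV _ V1 V'1 eqV]]] :=
  covering_nbhs_eq covu (erefl (u (s solenoid_one))).
have : \forall n \near \oo, V (s (x n)).
  have sx : (s \o x) @ \oo --> s solenoid_one := cvg_comp x s xcvg (@cs _).
  by apply: (sx V); exact: open_nbhs_nbhs.
case=> n _ /(_ n (leqnn n)) /= Vxn; have [pxn _] := xP n; apply.
by apply/(eqV _ _ Vxn V'1); rewrite // !us pxn.
Qed.

(** The first n coordinates of a point of the fibre are those of the image of 1
    under some iterate of the odometer; moving back by this iterate leads to the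
    neighbourhood of 1 on which s is constant. *)
Lemma lift_fibre_orbit : exists2 n,
  s (flow (k ^ n)%:R solenoid_one) = s solenoid_one &
  forall x, proj x = circle_one R ->
    exists j : nat, s x = s (flow j%:R solenoid_one).
Proof.
have [n near1] := lift_const_near_one; exists n.
  apply: near1; first by rewrite proj_flow_nat.
  rewrite limit_proj_flow divff ?powk_neq0 // -[1]/(1%:R) circle_exp_nat.
  by rewrite circle_mul1.
move=> x px.
have [t [t0 tE]] := circle_exp_surj (limit_proj n x).
have [j tj] : exists j : nat, t * (k ^ n)%:R = j%:R.
  apply: circle_exp_ker; first by rewrite mulr_ge0.
  by rewrite -circle_pow_exp tE limit_proj_pow.
exists j; rewrite -[x in LHS]flow0 -(subrr j%:R) flowD.
apply: lift_flow; first by rewrite proj_flowN_nat px.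
apply: near1; first by rewrite proj_flowN_nat.
rewrite limit_proj_flow -tE -tj mulNr mulfK ?powk_neq0 //.
by rewrite -circle_expD subrr circle_exp0.
Qed.

(** The odometer acts on the image of the fibre as a single cycle. *)
Lemma lift_fibre_card : exists n d, (d %| k ^ n)%N /\
  (s @` [set x | proj x = circle_one R] #= `I_d)%card.
Proof.
have [n per orb] := lift_fibre_orbit; exists n.
pose a (j : nat) := s (flow j%:R solenoid_one).
have [i j m|||d [dk ad]] := @periodic_range_card _ a _ (k ^ n).
- rewrite /a !natrD ![_ + m%:R]addrC !flowD; split => e; last first.
    by apply: lift_flow => //; rewrite !proj_flow_nat.
  have := @lift_flow (- m%:R) (flow m%:R (flow i%:R solenoid_one))
    (flow m%:R (flow j%:R solenoid_one)).
  rewrite -!flowD !addKr; apply; last by rewrite !flowD.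
  by rewrite !flowD !proj_flow_nat.
- by rewrite expn_gt0 k0.
- by rewrite /a per flow0.
exists d; split => //; rewrite (_ : s @` _ = range a) //.
apply/seteqP; split => [_ [x /orb[j sx] <-]|_ [j _ <-]]; first by exists j.
by exists (flow j%:R solenoid_one) => //; rewrite /= proj_flow_nat.
Qed.

(** The factorization is continuous because the circle is a quotient of the line
    and the flow line of 1 lifts the quotient map to the solenoid. *)
Lemma lift_descends :
  (forall x y, proj x = circle_one R -> proj y = circle_one R -> s x = s y) ->
  exists2 sg : circle -> E, continuous sg & forall x, sg (proj x) = s x.
Proof.
move=> sC.
have /choice[log logK] : forall z : circle, exists t : R, circle_exp t = z.
  by move=> z; have [t []] := circle_exp_surj z; exists t.
pose sg z := s (flow (log z) solenoid_one).
have proj1 : proj solenoid_one = circle_one R by [].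
have sgE x : sg (proj x) = s x.
  set t := log (proj x).
  have pNt : proj (flow (- t) x) = circle_one R.
    by rewrite solenoid_proj_flow -[proj x]logK -circle_expD subrr circle_exp0.
  rewrite -[x in RHS]flow0 -(subrr t) flowD /sg -/t.
  by apply: lift_flow; [rewrite pNt|exact: sC].
exists sg => //; apply: continuous_from_circle.
have -> : sg \o @circle_exp R = s \o flow^~ solenoid_one.
  apply/funext => t /=; rewrite -sgE solenoid_proj_flow proj1.
  by rewrite circle_mulC circle_mul1.
by move=> t; apply: continuous_comp; [exact: flow_continuous|exact: cs].
Qed.
End lift.
End solenoid.

(** * The 2-3 solenoid *)

Section solenoid23.
Variable R : realType.
Local Notation circle := (circle R).
Local Notation one := (circle_one R).
Local Notation Sol2 := (solenoid R 2).
Local Notation Sol3 := (solenoid R 3).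
Local Notation p := (@solenoid_proj R 2).
Local Notation q := (@solenoid_proj R 3).
Variable f : fibre p one -> fibre q one.

Definition from_left (x : Sol2) : solenoid23 f :=
  \pi_(adjunction (solenoid23_attach f))%qT (in_left Sol3 x).
Definition from_right (y : Sol3) : solenoid23 f :=
  \pi_(adjunction (solenoid23_attach f))%qT (in_right Sol2 y).

Lemma from_left_continuous : continuous from_left.
Proof.
move=> x; have := @continuous_comp Sol2 (disjoint_union Sol2 Sol3)
  (solenoid23 f) (@in_left Sol2 Sol3)
  (\pi_(adjunction (solenoid23_attach f))%qT) x.
apply; last exact: pi_continuous.
exact: (@existT_continuous bool (pair_family Sol2 Sol3) false).
Qed.

Lemma from_right_continuous : continuous from_right.
Proof.
move=> x; have := @continuous_comp Sol3 (disjoint_union Sol2 Sol3)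
  (solenoid23 f) (@in_right Sol2 Sol3)
  (\pi_(adjunction (solenoid23_attach f))%qT) x.
apply; last exact: pi_continuous.
exact: (@existT_continuous bool (pair_family Sol2 Sol3) true).
Qed.

Lemma from_leftE (x : fibre p one) :
  from_left (set_val x) = from_right (set_val (f x)).
Proof. exact: glueE. Qed.

Lemma proj_from_left x : solenoid23_proj (from_left x) = wedge_in false (p x).
Proof. exact: solenoid23_projE. Qed.

Lemma proj_from_right y : solenoid23_proj (from_right y) = wedge_in true (q y).
Proof. exact: solenoid23_projE. Qed.

Lemma solenoid23_cases (P : solenoid23 f -> Prop) :
  (forall x, P (from_left x)) -> (forall y, P (from_right y)) -> forall x, P x.
Proof.
move=> Pl Pr x; rewrite -[x](@reprK _ (adjunction (solenoid23_attach f))).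
by case: (repr _) => -[].
Qed.

(** Constant on the classes of the gluing and the identity on the right solenoid,
    which makes [from_right] injective.  Any value would do at the points of the
    left solenoid outside the fibre, which are identified with no other point. *)
Definition right_value (s : disjoint_union Sol2 Sol3) : Sol3 :=
  match s with
  | existT false x => oapp (fun x => set_val (f x)) (solenoid_one R 3) (insub x)
  | existT true y => y
  end.

Lemma from_right_inj : injective from_right.
Proof.
move=> y y' /glue_eqP h.
suff : right_value (in_right Sol2 y) = right_value (in_right Sol2 y') by [].
elim: h => // [_ _ [x]|a b c _ -> _ -> //].
by rewrite /= valK.
Qed.

(** The points 1 and flow 1 1: their next coordinates are 1 and a primitive cube
    root of unity. *)
Lemma from_right_not_const : exists y y', [/\ q y = one, q y' = one &
  from_right y <> from_right y'].
Proof.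
have k0 : (0 < 3)%N by [].
exists (solenoid_one R 3), (flow k0 1%:R (solenoid_one R 3)).
split=> //; first by rewrite proj_flow_nat.
move=> /from_right_inj /(congr1 (limit_proj 1)).
rewrite limit_proj_flow expn1 circle_mulC circle_mul1 => /esym.
have t0 : 0 <= (1%:R / 3%:R : R) by rewrite divr_ge0.
case/(circle_exp_ker t0) => j jE.
have : 1%:R == (j * 3)%:R :> R by rewrite natrM -jE divfK // pnatr_eq0.
by rewrite eqr_nat; case: j {jE}.
Qed.

Section lift.
Hypothesis hf : homeomorphism f.
Variables (E : topologicalType) (u : E -> wedge_circles R).
Variable s : solenoid23 f -> E.
Hypothesis covu : covering_map u.
Hypothesis cs : continuous s.
Hypothesis us : forall x, u (s x) = solenoid23_proj x.

Let k2 : (0 < 2)%N := isT.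
Let k3 : (0 < 3)%N := isT.

Let c2 : continuous (s \o from_left).
Proof.
by move=> x; apply: continuous_comp; [exact: from_left_continuous|exact: cs].
Qed.

Let c3 : continuous (s \o from_right).
Proof.
by move=> x; apply: continuous_comp; [exact: from_right_continuous|exact: cs].
Qed.

Let u2 x : u ((s \o from_left) x) = wedge_in false (p x).
Proof. by rewrite /= us proj_from_left. Qed.

Let u3 x : u ((s \o from_right) x) = wedge_in true (q x).
Proof. by rewrite /= us proj_from_right. Qed.

Lemma fibre_images_eq : (s \o from_left) @` [set x | p x = one] =
  (s \o from_right) @` [set y | q y = one].
Proof.
have [_ [g [_ _ gK]]] := hf.
apply/seteqP; split => _ [x /= px <-].
  pose x' : fibre p one := exist _ x (mem_set px).
  exists (set_val (f x')); first exact: (set_valP (f x')).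
  by rewrite -from_leftE.
pose x' : fibre q one := exist _ x (mem_set px).
exists (set_val (g x')); first exact: (set_valP (g x')).
by rewrite from_leftE gK.
Qed.

(** The cardinal of the common image of the two fibres divides a power of 2 and a
    power of 3. *)
Lemma lift_fibre_const : exists e,
  (forall x, p x = one -> s (from_left x) = e) /\
  (forall y, q y = one -> s (from_right y) = e).
Proof.
have [n [d [dn cd]]] := lift_fibre_card k2 covu c2 u2.
have [n' [d' [dn' cd']]] := lift_fibre_card k3 covu c3 u3.
have dd' : d = d'.
  apply/card_eq_II; apply: card_eq_trans cd'; rewrite -fibre_images_eq.
  by rewrite card_eq_sym.
have d1 : d = 1%N.
  apply/eqP; rewrite -dvdn1 -(_ : gcdn (2 ^ n) (3 ^ n') = 1%N).
    by rewrite dvdn_gcd dn dd' dn'.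
  by apply/eqP; rewrite -/(coprime _ _) coprimeXl // coprimeXr.
move: cd; rewrite d1 => /eq_cardSP[e Ke]; rewrite II0 card_eq0 => /eqP Ke0.
have eE : (s \o from_left) @` [set x | p x = one] = [set e].
  by rewrite -(setD1K Ke) Ke0 setU0.
exists e; split.
  by move=> x px; have : [set e] (s (from_left x)) by rewrite -eE; exists x.
move=> y qy; have : [set e] (s (from_right y)) => //.
by rewrite -eE fibre_images_eq; exists y.
Qed.

(** On each of the two circles s descends by [lift_descends]; the two maps agree at
    the wedge point, where both take the single value of s on the fibre. *)
Lemma lift_section : exists2 sg : wedge_circles R -> E, continuous sg &
  forall x, sg (solenoid23_proj x) = s x.
Proof.
have [e [e2 e3]] := lift_fibre_const.
have [x y px py|sg2 csg2 sg2E] := lift_descends k2 covu c2 u2.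
  by rewrite /= !e2.
have [x y px py|sg3 csg3 sg3E] := lift_descends k3 covu c3 u3.
  by rewrite /= !e3.
pose sgs (i : bool) : circle -> E := if i then sg3 else sg2.
have sgs1 i : sgs i one = e.
  case: i; rewrite /=.
    by rewrite -(_ : q (solenoid_one R 3) = one) // sg3E /= e3.
  by rewrite -(_ : p (solenoid_one R 2) = one) // sg2E /= e2.
exists (wedge_fun (p0 := fun=> one) sgs).
  by apply: wedge_fun_continuous => [[]//|i j]; rewrite !sgs1.
apply: solenoid23_cases => x.
  rewrite proj_from_left [LHS]wedge_lift_funE; first exact: sg2E.
  by move=> i j; rewrite !sgs1.
rewrite proj_from_right [LHS]wedge_lift_funE; first exact: sg3E.
by move=> i j; rewrite !sgs1.
Qed.

Lemma solenoid23_proj_surj z : exists x : solenoid23 f, solenoid23_proj x = z.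
Proof.
have : (\bigcup_i (@wedge_lift bool (fun=> circle) (fun=> one) i) @` setT) z.
  by rewrite wedgeTE.
have flowE k (k0 : (0 < k)%N) t :
    solenoid_proj (flow k0 t (solenoid_one R k)) = circle_exp t.
  by rewrite solenoid_proj_flow circle_mulC circle_mul1.
case=> -[] _ [w _ <-]; have [t [_ <-]] := circle_exp_surj w.
  exists (from_right (flow k3 t (solenoid_one R 3))).
  by rewrite proj_from_right flowE.
exists (from_left (flow k2 t (solenoid_one R 2))).
by rewrite proj_from_left flowE.
Qed.

Lemma lift_trivial : connected [set: E] -> trivial_one_sheeted u.
Proof.
move=> cE; have [sg csg sgE] := lift_section.
have usg z : u (sg z) = z.
  by have [x <-] := solenoid23_proj_surj z; rewrite sgE us.
have sgu x : sg (u x) = x.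
  apply: (@unique_lifting _ _ _ u covu (sg \o u) id
    (sg (wedge_in true one))) => //.
  - by move=> y; apply: continuous_comp; [exact: covu.1|exact: csg].
  - by move=> y; exact: cvg_id.
  - by move=> y; exact: usg.
  - by congr sg; exact: usg.
exists u; split => //; split; first exact: covu.1.
by exists sg.
Qed.

End lift.
End solenoid23.

Theorem proposition3p3 (R : realType)
  (f : fibre (@solenoid_proj R 2) (circle_one R) ->
       fibre (@solenoid_proj R 3) (circle_one R))
  (hf : homeomorphism f) :
  (forall (X : topologicalType) (u : X -> wedge_circles R)
          (s : solenoid23 f -> X),
     covering_map u ->
     connected (@setT X) ->
     continuous s ->
     (forall x : solenoid23 f, u (s x) = solenoid23_proj x) ->
     trivial_one_sheeted u) /\
  ~ inverse_limit_of_coverings (@solenoid23_proj R f).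
Proof.
split=> [X u s covu cX cs us|].
  exact: (lift_trivial hf covu cs us cX).
case=> X [b [u [covu cb ub [h [[ch [g [cg hK gK]]] rh]]]]].
have [y [y' [qy qy']]] := from_right_not_const f; apply.
apply: (can_inj gK); apply: limit_eqP => n.
(* The coordinates of g are maps over the wedge to each covering of the
   sequence, by compatibility of the bonding maps with the projections. *)
have un m x : u m (limit_proj m (g x)) = solenoid23_proj x.
  rewrite -[x in RHS]gK rh; elim: m => // m IH.
  by rewrite -ub (limit_projS m (g x)) IH.
have cn : continuous (fun x => limit_proj n (g x)).
  by move=> x; apply: (continuous_comp (cg x)); exact: limit_proj_continuous.
have [e [_ eE]] := lift_fibre_const hf (covu n) cn (un n).
by rewrite !eE.
Qed.
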